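(* Let $m,n$ be positive integers and $\xi$ a transcendental real number. Then \[ \min\{w_{m}(\xi),\widehat{w}_{n}(\xi)\}\leq m+n-1. \]
   Context: The height $H(P)$ of an integer polynomial $P$ is the maximum of the absolute values of its coefficients. For a real number $\xi$ and integer $k\ge1$: $w_{k}(\xi)\in[0,+\infty]$ is the supremum of the real numbers $w$ such that $0<|P(\xi)|\le H(P)^{-w}$ has infinitely many solutions $P\in\mathbb{Z}[X]$ of degree at most $k$; $\widehat{w}_{k}(\xi)$ is the supremum of the real numbers $w$ such that for all sufficiently large $H$ the system $0<|P(\xi)|\le H^{-w}$, $H(P)\le H$, has a solution $P\in\mathbb{Z}[X]$ of degree at most $k$. *)

(* Defs.v *)
From mathcomp Require Import all_boot all_order all_algebra.
From mathcomp Require Import all_classical all_reals all_analysis.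

Set Implicit Arguments.
Unset Strict Implicit.
Unset Printing Implicit Defensive.

Import Order.TTheory GRing.Theory Num.Theory.
Import numFieldNormedType.Exports.

Local Open Scope classical_set_scope.
Local Open Scope ring_scope.

Definition height (P : {poly int}) : nat :=
  (\max_(i < size P) absz (P`_i)%R)%N.

Definition transcendental (R : realType) (xi : R) : Prop :=
  ~ algebraicOver (ratr : rat -> R) xi.

Definition peval (R : realType) (P : {poly int}) (xi : R) : R :=
  (map_poly intr P).[xi].

(* [size P <= k.+1] says that P has degree at most k; the zero polynomial is
   excluded by [0 < `|peval P xi|], so the base of the power is at least 1. *)
Definition w_set (R : realType) (k : nat) (xi : R) : set R :=
  [set w | infinite_set [set P : {poly int} |
     (size P <= k.+1)%N /\
     0 < `|peval P xi| <= (height P)%:R `^ (- w)]].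

Definition what_set (R : realType) (k : nat) (xi : R) : set R :=
  [set w | \forall H \near (+oo : set_system R), exists P : {poly int},
     [/\ (size P <= k.+1)%N,
         0 < `|peval P xi| <= H `^ (- w) &
         (height P)%:R <= H]].

Definition w_exp (R : realType) (k : nat) (xi : R) : \bar R :=
  ereal_sup [set w%:E | w in w_set k xi].

Definition what_exp (R : realType) (k : nat) (xi : R) : \bar R :=
  ereal_sup [set w%:E | w in what_set k xi].

(* Main.v *)
Require Import Defs.
From mathcomp Require Import all_boot all_order all_algebra.
From mathcomp Require Import all_classical all_reals all_analysis.
From mathcomp Require Import ring lra.

Set Implicit Arguments.
Unset Strict Implicit.
Unset Printing Implicit Defensive.

Import Order.TTheory GRing.Theory Num.Theory.

Local Open Scope ring_scope.

(** Put [t = m + n - 1] and suppose both exponents exceed [t].  Then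
    [|P(xi)| H(P)^t] takes arbitrarily small values on nonzero polynomials of
    degree at most [m]; let [d] be the least degree bound for which this
    remains true.  By Gelfond's inequality [H(B) H(C) <= c H(BC)] the quantity
    is multiplicative up to a constant, so a primitive [A] of degree [d] making
    it very small has no proper factor.  Take [Q] of degree at most [n] given
    by the uniform exponent at height [H(A) / (2c)]: it cannot be a multiple of
    [A], so [A] and [Q] are coprime and their resultant is a nonzero integer.
    But the resultant is [O(H(A)^t (|A(xi)| + |Q(xi)|))], which is less
    than [1]. *)

(** * Heights of integer polynomials *)

Lemma coef_le_height (P : {poly int}) i : (absz (P`_i)%R <= height P)%N.
Proof.
have [le_si | lt_is] := leqP (size P) i; first by rewrite nth_default.
exact: (leq_bigmax (Ordinal lt_is)).
Qed.

Lemma height_coef (P : {poly int}) : exists i, height P = absz (P`_i)%R.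
Proof.
have [-> | nzP] := eqVneq P 0.
  by exists 0%N; rewrite /height coef0 big1 // => i _; rewrite coef0.
have : (0 < #|'I_(size P)|)%N by rewrite card_ord size_poly_gt0.
by case/(bigop.eq_bigmax (fun i : 'I_(size P) => absz (P`_i)%R)) => i ei;
  exists i.
Qed.

Lemma height_gt0 (P : {poly int}) : P != 0 -> (0 < height P)%N.
Proof.
rewrite -lead_coef_eq0 -absz_gt0 => lt0.
exact: leq_trans lt0 (coef_le_height P _).
Qed.

(** * Interpolation at integer nodes and Gelfond's inequality *)

Section Bounds.

Variable R : realType.
Implicit Types (P Q : {poly int}).

Lemma norm_coef_le_height P i : `|(map_poly intr P)`_i : R| <= (height P)%:R.
Proof.
by rewrite coef_map /= -intr_norm -abszE -pmulrn ler_nat coef_le_height.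
Qed.

Lemma norm_peval_le P (x X : R) L : 1 <= X -> `|x| <= X -> (size P <= L)%N ->
  `|peval P x| <= L%:R * X ^+ L * (height P)%:R.
Proof.
move=> X1 xX sP; have X0 : 0 <= X by apply: le_trans X1.
rewrite /peval (horner_coef_wide _ (leq_trans (size_poly _ _) sP)).
apply: le_trans (ler_norm_sum _ _ _) _.
have -> : L%:R * X ^+ L * (height P)%:R
    = \sum_(i < L) ((height P)%:R * X ^+ L) :> R.
  by rewrite sumr_const card_ord -mulr_natl; ring.
apply: ler_sum => i _; rewrite normrM normrX.
apply: ler_pM; rewrite ?exprn_ge0 ?norm_coef_le_height //.
apply: le_trans (_ : X ^+ i <= _); first exact: lerXn2r.
by rewrite ler_weXn2l // ltnW.
Qed.

(** Induction on the number of nodes: distinct integer nodes differ by at least 1, so a divided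
    difference at most doubles the bound [E]. The constant does not depend on the choice of nodes
    below [N], since the nodes used later vary with the polynomial. *)
Lemma interpolation_bound (N d : nat) : exists2 C : R, 0 <= C &
  forall (s : seq nat) (p : {poly R}) (E : R),
    size s = d -> uniq s -> (forall x, x \in s -> (x <= N)%N) ->
    (size p <= d)%N -> (forall x, x \in s -> `|p.[x%:R]| <= E) ->
  forall i, `|p`_i| <= C * E.
Proof.
elim: d => [|d [C C0 IH]].
  exists 0 => // s p E _ _ _; rewrite leqn0 size_poly_eq0 => /eqP-> _ i.
  by rewrite coef0 normr0 mul0r.
(* In [p = q * (X - x0) + p(x0)] the three contributions to a coefficient are at most [2CE], [2CEN]
   and [E]. *)
exists (N.+1%:R * (2 * C) + 1); first by rewrite addr_ge0 // !mulr_ge0.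
case=> [//|x0 s] p E [ss] /= /andP[x0s us] sN sp pE i.
have E0 : 0 <= E by apply: le_trans (pE x0 (mem_head _ _)).
(* Newton's divided difference at [x0] lowers the degree *)
have /factor_theorem[q qE] : root (p - p.[x0%:R]%:P) (x0%:R).
  by rewrite /root hornerD hornerN hornerC subrr.
have pE' : p = q * ('X - x0%:R%:P) + p.[x0%:R]%:P by rewrite -qE subrK.
have sq : (size q <= d)%N.
  have [->|q0] := eqVneq q 0; first by rewrite size_poly0.
  have sqX : size (q * ('X - x0%:R%:P)) = (size q).+1.
    by rewrite size_Mmonic ?monicXsubC // size_XsubC addn2.
  rewrite -ltnS -sqX -qE (leq_trans (size_polyD _ _)) // geq_max sp size_polyN.
  by rewrite (leq_trans (size_polyC_leq1 _)).
have qC j : `|q`_j| <= C * (2 * E).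
  apply: IH ss us _ sq _ j => [x xs|x xs]; first by rewrite sN // inE xs orbT.
  have nx : x != x0 by apply: contraNneq x0s => <-.
  have d1 : 1 <= `|x%:R - x0%:R : R|.
    have [lt|lt|e] := ltngtP x x0; last by rewrite e eqxx in nx.
      by rewrite distrC -natrB ?normr_nat ?ler1n ?subn_gt0 // ltnW.
    by rewrite -natrB ?normr_nat ?ler1n ?subn_gt0 // ltnW.
  have -> : 2 * E = E + E by ring.
  apply: le_trans (_ : `|q.[x%:R]| * `|x%:R - x0%:R| <= _).
    by rewrite ler_peMr.
  rewrite -normrM.
  have -> : q.[x%:R] * (x%:R - x0%:R) = p.[x%:R] - p.[x0%:R].
    by rewrite {1}pE' !hornerE addrK.
  apply: le_trans (ler_normB _ _) _.
  by rewrite lerD // pE // ?mem_head // inE xs orbT.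
have x0N : x0%:R <= N%:R :> R by rewrite ler_nat sN ?mem_head.
have p0E : `|p.[x0%:R]| <= E by rewrite pE ?mem_head.
rewrite pE' coefD coefC mulrBr coefB coefMX coefMC.
have h1 : `|if i == 0%N then 0 else q`_i.-1| <= C * (2 * E).
  by case: ifP => _ //; rewrite normr0 !mulr_ge0.
have h2 : `|q`_i * x0%:R| <= C * (2 * E) * N%:R.
  by rewrite normrM ler_pM // normr_nat.
have h3 : `|if i == 0%N then p.[x0%:R] else 0| <= E.
  by case: ifP => // _; rewrite normr0.
apply: le_trans (ler_normD _ _) _.
apply: le_trans (lerD (ler_normB _ _) (lexx _)) _.
apply: le_trans (lerD (lerD h1 h2) h3) _.
by rewrite -natr1 le_eqVlt; apply/orP; left; apply/eqP; ring.
Qed.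


Lemma pevalM P Q (x : R) : peval (P * Q) x = peval P x * peval Q x.
Proof. by rewrite /peval rmorphM hornerM. Qed.

(* Gelfond's inequality.  A nonzero polynomial of size at most [K] is small
   at fewer than [K] of [2 * K] points, so both factors are large at one of
   them. *)
Lemma height_mul_le (K : nat) : exists2 c : R, 0 < c & forall P Q,
  (size P <= K)%N -> (size Q <= K)%N ->
  (height P)%:R * (height Q)%:R <= c * (height (P * Q))%:R.
Proof.
have [C C0 CP] := interpolation_bound (K.*2) K.
(* Being bad at [K] points would give [B <= C] by interpolation, which this choice excludes. *)
pose B := 2 * (C + 1).
have B0 : 0 < B by rewrite mulr_gt0 // ltr_wpDl.
(* [X] dominates all sample points, and the successor keeps [1 <= X] when [K] is 0. [D] then bounds
   the values of [P * Q] in terms of its height. *)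
pose X : R := (K.*2).+1%:R; pose D : R := (K.*2).+1%:R * X ^+ (K.*2).+1.
have D0 : 0 < D by rewrite mulr_gt0 // exprn_gt0.
have BBD0 : 0 < B * B * D by apply: mulr_gt0 (mulr_gt0 B0 B0) D0.
exists (B * B * D) => // P Q sP sQ.
have [->|P0] := eqVneq P 0.
  by rewrite {1}/height size_poly0 big_ord0 mul0r mulr_ge0 // ltW.
have [->|Q0] := eqVneq Q 0.
  by rewrite {2}/height size_poly0 big_ord0 mulr0 mulr_ge0 // ltW.
pose bad (S : {poly int}) (k : nat) :=
  B * `|peval S (k%:R : R)| < (height S)%:R.
have badK (S : {poly int}) : S != 0 -> (size S <= K)%N ->
    (count (bad S) (iota 0 K.*2) < K)%N.
  move=> S0 sS; rewrite ltnNge -size_filter; apply/negP => le.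
  set s := [seq k <- iota 0 K.*2 | bad S k] in le.
  have [i hi] := height_coef S.
  have h0 : 0 < (height S)%:R :> R by rewrite ltr0n height_gt0.
  have mem_s k : k \in take K s -> bad S k /\ (k <= K.*2)%N.
    move/mem_take; rewrite mem_filter mem_iota add0n => /andP[bk /andP[_ kK]].
    by split=> //; apply: ltnW.
  have us : uniq (take K s) by rewrite take_uniq // filter_uniq // iota_uniq.
  have := CP (take K s) (map_poly intr S) ((height S)%:R / B).
  move/(_ (size_takel le) us).
  move/(_ (fun k ks => (mem_s k ks).2) (leq_trans (size_poly _ _) sS)).
  have h k : k \in take K s ->
      `|(map_poly intr S).[k%:R]| <= (height S)%:R / B :> R.
    by case/mem_s => /ltW bk _; rewrite ler_pdivlMr // mulrC.
  move=> /(_ h i); rewrite coef_map /= -intr_norm -abszE -pmulrn -hi.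
  rewrite mulrA ler_pdivlMr // mulrC ler_pM2r // /B.
  by apply/negP; rewrite -ltNge; lra.
have /hasP[k] : has (predC (predU (bad P) (bad Q))) (iota 0 K.*2).
  rewrite has_predC all_count size_iota neq_ltn.
  apply/orP; left.
  pose both := count (predI (bad P) (bad Q)) (iota 0 K.*2).
  apply: leq_ltn_trans (leq_addr both _) _.
  rewrite count_predUI -[ltnRHS]addnn -addSn; apply: leq_add; first exact: badK.
  exact: ltnW (badK _ Q0 sQ).
rewrite mem_iota add0n => /andP[_ kK] /=; rewrite negb_or /bad -!leNgt.
case/andP=> hP hQ.
apply: le_trans (ler_pM _ _ hP hQ) _ => //.
have -> : B * `|peval P k%:R| * (B * `|peval Q k%:R|)
   = B * B * `|peval (P * Q) (k%:R : R)|.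
  by rewrite pevalM normrM; ring.
rewrite -[leRHS]mulrA ler_pM2l; last exact: mulr_gt0.
apply: norm_peval_le; first by rewrite ler1n.
  by rewrite normr_nat ler_nat (leq_trans (ltnW kK)).
apply: leq_trans (size_polyMleq _ _) _.
by rewrite -addnn (leq_trans (leq_pred _)) // ltnW // ltnS leq_add.
Qed.

(** * Determinants and a lower bound from the resultant *)

Lemma norm_det_le n (A : 'M[R]_n) H :
  (forall i j, `|A i j| <= H) -> `|\det A| <= n`!%:R * H ^+ n.
Proof.
move=> AH; apply: le_trans (ler_norm_sum _ _ _) _.
rewrite -perm.card_Sn mulr_natl -sumr_const.
apply: ler_sum => s _; rewrite normrM normrX normrN1 expr1n mul1r normr_prod.
rewrite -[X in H ^+ X]card_ord -prodr_const.
by apply: ler_prod => i _; rewrite AH normr_ge0.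
Qed.

(** Since [det A * v = adj A * (A v)], row [i0] writes the determinant as a combination of the
    entries of [A v], with minors of order [n - 1] as coefficients. This saves one power of [H] over
    the Leibniz bound. *)
Lemma norm_det_le_mulmx n (A : 'M[R]_n) (v : 'cV[R]_n) i0 H e :
  v i0 0 = 1 -> (forall i j, `|A i j| <= H) ->
  (forall i, `|(A *m v) i 0| <= e) ->
  `|\det A| <= n%:R * (n.-1`!%:R * H ^+ n.-1) * e.
Proof.
move=> v1 AH Ave.
have -> : \det A = (\adj A *m (A *m v)) i0 0.
  by rewrite mulmxA mul_adj_mx mul_scalar_mx mxE v1 mulr1.
rewrite mxE; apply: le_trans (ler_norm_sum _ _ _) _.
rewrite -mulrA -[X in X%:R * _]card_ord mulr_natl -sumr_const.
apply: ler_sum => i _; rewrite normrM ler_pM // mxE /cofactor.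
rewrite normrM normrX normrN1 expr1n mul1r.
by apply: norm_det_le => j k; rewrite !mxE.
Qed.

(** This evaluates a row of the Sylvester matrix on the vector of powers of [x]. *)
Lemma sum_shifted_coef (p : {poly R}) (x : R) N k :
  (size p + k <= N)%N ->
  \sum_(j < N) (p`_(j - k) *+ (k <= j)) * x ^+ j = x ^+ k * p.[x].
Proof.
move=> sN; have -> : x ^+ k * p.[x] = (p * 'X^k).[x] by rewrite !hornerE mulrC.
rewrite (@horner_coef_wide _ N); last first.
  by rewrite (leq_trans (size_polyMleq _ _)) // size_polyXn addnS.
apply: eq_bigr => j _; rewrite coefMXn ltnNge.
by case: leqP => _; rewrite ?mulr1n ?mulr0n.
Qed.

(** A nonzero integer has absolute value at least 1. The Sylvester matrix sends the vector of powers
    of [x] to entries [x^k P(x)] and [x^k Q(x)], all at most [X^N e], and the previous determinant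
    bound applies. *)
Lemma resultant_ge1 (P Q : {poly int}) (x X H e : R) N :
  N = ((size Q).-1 + (size P).-1)%N ->
  resultant P Q != 0 -> 1 <= X -> `|x| <= X ->
  (1 < size P)%N -> Q != 0 ->
  (height P)%:R <= H -> (height Q)%:R <= H ->
  `|peval P x| <= e -> `|peval Q x| <= e ->
  1 <= N%:R * (N.-1`!%:R * H ^+ N.-1) * (X ^+ N * e).
Proof.
move=> -> res0 X1 xX sP Q0 PH QH Pe Qe; set M := ((size Q).-1 + _)%N.
have sQ : (0 < size Q)%N by rewrite size_poly_gt0.
have H0 : 0 <= H by apply: le_trans PH.
have e0 : 0 <= e by apply: le_trans Pe.
have X0 : 0 <= X by apply: le_trans X1.
(* A positive dimension provides the entry [x^0 = 1] that the determinant bound requires. *)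
have M0 : (0 < M)%N by rewrite addn_gt0 -!subn1 !subn_gt0 sP orbT.
pose A := map_mx (intr : int -> R) (Sylvester_mx P Q).
apply: le_trans (_ : `|\det A| <= _).
  rewrite det_map_mx -intr_norm -/(resultant P Q) -abszE -pmulrn ler1n.
  by rewrite absz_gt0.
have AE i j : A i j = match fintype.split i with
    | inl k => (map_poly intr P)`_(j - k) *+ (k <= j)
    | inr k => (map_poly intr Q)`_(j - k) *+ (k <= j) end.
  by rewrite mxE Sylvester_mxE; case: fintype.split => k;
     rewrite coef_map rmorphMn.
have pH (S : {poly int}) : (height S)%:R <= H ->
    forall a (b : bool), `|(map_poly intr S)`_a *+ b : R| <= H.
  move=> SH a [] /=; last by rewrite mulr0n normr0.
  by rewrite mulr1n (le_trans (norm_coef_le_height _ _)).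
apply: (@norm_det_le_mulmx _ A (\col_j x ^+ j) (Ordinal M0)).
- by rewrite mxE expr0.
- by move=> i j; rewrite AE; case: fintype.split => k; apply: pH.
move=> i.
have bnd (y : R) k : (k <= M)%N -> `|y| <= e -> `|x ^+ k * y| <= X ^+ M * e.
  move=> kM ye; rewrite normrM normrX ler_pM ?exprn_ge0 //.
  apply: le_trans (_ : X ^+ k <= _); first exact: lerXn2r.
  by rewrite ler_weXn2l.
rewrite mxE; under eq_bigr do rewrite AE mxE.
case: fintype.split => k.
  rewrite sum_shifted_coef; first by rewrite bnd // ltnW // ltn_addr.
  have := ltn_ord k; have := size_poly (size P) (fun i => (P`_i)%:~R : R).
  rewrite -/(map_poly _ _) => h1 h2.
  apply: leq_trans (leq_add h1 (leqnn _)) _.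
  by rewrite -(prednK (ltnW sP)) addSn -addnS addnC leq_add2r.
rewrite sum_shifted_coef; first by rewrite bnd // ltnW // ltn_addl.
have := ltn_ord k; have := size_poly (size Q) (fun i => (Q`_i)%:~R : R).
rewrite -/(map_poly _ _) => h1 h2.
apply: leq_trans (leq_add h1 (leqnn _)) _.
by rewrite -(prednK sQ) addSn -addnS leq_add2l.
Qed.

End Bounds.

(** * Finiteness of the polynomials of bounded degree and height *)

Lemma finite_bounded_height (L N : nat) :
  finite_set
    [set P : {poly int} | (size P <= L)%N /\ (height P <= N)%N]%classic.
Proof.
pose F (f : {ffun 'I_L -> 'I_(N + N).+1}) : {poly int} :=
  rVpoly (\row_i ((f i)%:Z - N%:Z)).
apply: (@sub_finite_set _ _ (F @` [set: _])%classic); last first.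
  exact/finite_image/finite_finset.
(* Adding [N] moves the coefficients from [[-N, N]] into [[0, 2N]], the range of the finite
   functions. *)
move=> P [sP hP]; exists [ffun i : 'I_L => inord (absz (P`_i + N%:Z))] => //.
rewrite /F -[RHS](poly_rV_K sP); congr rVpoly; apply/rowP => i.
rewrite !mxE ffunE.
have /leq_trans/(_ hP) := coef_le_height P i.
rewrite -lez_nat abszE ler_norml => /andP[lo hi].
have ge0 : 0 <= P`_i + N%:Z by rewrite -lerBlDr sub0r.
rewrite inordK; first by rewrite gez0_abs // addrK.
by rewrite ltnS -lez_nat gez0_abs // PoszD lerD2r.
Qed.

(** * Small values supplied by the two exponents, and a uniform resultant bound *)

Section Approximation.

Variable R : realType.
Implicit Types (P Q : {poly int}).

Lemma transcendental_peval_neq0 (xi : R) P :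
  transcendental xi -> P != 0 -> peval P xi != 0.
Proof.
move=> tr P0; apply: contra_notN tr => /eqP Pxi.
exists (map_poly intr P).
  by rewrite map_poly_eq0_id0 // intr_eq0 lead_coef_eq0.
rewrite -map_poly_comp /root (eq_map_poly (g := intr)).
  by rewrite -/(peval P xi) Pxi.
by move=> a /=; rewrite ratr_int.
Qed.

(** Finitely many nonzero values have a positive minimum. Used in the contrapositive: a small enough
    value forces a large height. *)
Lemma peval_gt_of_bounded_height (xi : R) (L N : nat) : transcendental xi ->
  exists2 d : R, 0 < d & forall P, P != 0 -> (size P <= L)%N ->
    (height P <= N)%N -> d < `|peval P xi|.
Proof.
move=> tr; have /finite_seqP[s sE] := finite_bounded_height L N.
have [d d0 dP] : exists2 d : R, 0 < d &
    forall P, P \in s -> P != 0 -> d < `|peval P xi|.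
  elim: s {sE} => [|P s [d d0 IH]]; first by exists 1.
  have [->|P0] := eqVneq P 0.
    by exists d => // Q; rewrite inE => /predU1P[->|/IH //]; rewrite eqxx.
  have Pxi : 0 < `|peval P xi| by rewrite normr_gt0 transcendental_peval_neq0.
  exists (Num.min d (`|peval P xi| / 2)); first by rewrite lt_min d0 divr_gt0.
  move=> Q; rewrite inE gt_min => /predU1P[-> _|Qs Q0]; last by rewrite IH.
  by apply/orP; right; lra.
exists d => // P P0 sP hP; apply: dP => //.
by have : [set` s]%classic P by rewrite -sE.
Qed.

Lemma powR_absorb (w : R) (t : nat) : t%:R < w -> forall eps : R, 0 < eps ->
  exists2 H0 : R, 1 <= H0 & forall H, H0 <= H -> H `^ (- w) * H ^+ t <= eps.
Proof.
move=> tw eps e0; pose s := w - t%:R.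
have s0 : 0 < s by rewrite subr_gt0.
(* The product equals [H^(-s)], and [eps^(-1/s)] is where this reaches [eps]. *)
exists (Num.max 1 (eps^-1 `^ s^-1)); first by rewrite le_max lexx.
move=> H; rewrite ge_max => /andP[H1 He].
have H0 : 0 < H by apply: lt_le_trans H1.
rewrite -powR_mulrn ?(ltW H0) // -powRD; last by rewrite (gt_eqF H0) implybT.
have -> : - w + t%:R = - s by rewrite /s; ring.
rewrite powRN -[leRHS]invrK lef_pV2 ?posrE ?powR_gt0 ?invr_gt0 //.
have -> : eps^-1 = (eps^-1 `^ s^-1) `^ s.
  by rewrite -powRrM mulVf ?gt_eqF // powRr1 // invr_ge0 ltW.
by apply: ge0_ler_powR; rewrite ?nnegrE ?powR_ge0 // ltW.
Qed.

(** Removing the finitely many polynomials of height at most [N] from an infinite set leaves a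
    solution of large height, where the surplus [w - t] beats [eps]. *)
Lemma w_set_small (xi w : R) (k t : nat) : w_set k xi w -> t%:R < w ->
  forall eps : R, 0 < eps -> exists P,
    [/\ P != 0, (size P <= k.+1)%N & `|peval P xi| * (height P)%:R ^+ t <= eps].
Proof.
move=> wk tw eps e0; have [H0 H1 HP] := powR_absorb tw e0.
pose N := Num.Def.archi_bound H0.
have HN : H0 < N%:R by apply: archi_boundP; apply: le_trans H1.
have [P [[sP /andP[P0 Pw]] nP]] :=
  infinite_setN0 (infinite_setD wk (finite_bounded_height k.+1 N)).
exists P; split=> //.
  by apply: contraTneq P0 => ->; rewrite /peval rmorph0 horner0 normr0 ltxx.
apply: le_trans (HP (height P)%:R _); first by rewrite ler_wpM2r ?exprn_ge0.
apply: le_trans (ltW HN) _; rewrite ler_nat leqNgt.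
by apply/negP => hP; apply: nP; split=> //; apply: ltnW.
Qed.

Lemma what_set_small (xi w : R) (k t : nat) : what_set k xi w -> t%:R < w ->
  forall eps : R, 0 < eps -> exists H0 : R, forall H, H0 <= H -> exists P,
    [/\ P != 0, (size P <= k.+1)%N, `|peval P xi| * H ^+ t <= eps
      & (height P)%:R <= H].
Proof.
move=> [H2 [_ wk]] tw eps e0; have [H0 H1 HP] := powR_absorb tw e0.
(* The neighbourhood of infinity gives solutions only for [H2 < H], strictly, whence [H2 + 1]. *)
exists (Num.max H0 (H2 + 1)) => H; rewrite ge_max => /andP[HH0 HH2].
have [|P [sP /andP[P0 Pw] hP]] := wk H; first by lra.
exists P; split=> //.
  by apply: contraTneq P0 => ->; rewrite /peval rmorph0 horner0 normr0 ltxx.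
apply: le_trans (HP H HH0); rewrite ler_wpM2r ?exprn_ge0 //.
by apply: le_trans HH0; apply: le_trans H1.
Qed.

(** The constant must serve all actual degrees at once; as [H] and [|xi| + 1] are at least 1, their
    exponents can be raised to those of the maximal degrees. *)
Lemma resultant_small (xi : R) (m n : nat) : (0 < m + n)%N ->
  exists2 G : R, 0 < G & forall P Q (H e : R),
    resultant P Q != 0 -> (1 < size P <= m.+1)%N -> Q != 0 ->
    (size Q <= n.+1)%N -> 1 <= H ->
    (height P)%:R <= H -> (height Q)%:R <= H ->
    `|peval P xi| <= e -> `|peval Q xi| <= e ->
  1 <= G * (H ^+ (m + n).-1 * e).
Proof.
move=> mn0; pose X := `|xi| + 1.
have X1 : 1 <= X by rewrite lerDr.
have X0 : 0 < X by apply: lt_le_trans X1.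
exists ((m + n)%:R * ((m + n)`!%:R * X ^+ (m + n))).
  by rewrite !mulr_gt0 ?exprn_gt0 ?ltr0n ?fact_gt0.
move=> P Q H e res0 /andP[sP Pm] Q0 Qn H1 PH QH Pe Qe.
have e0 : 0 <= e by apply: le_trans Pe.
have H0 : 0 <= H by apply: le_trans H1.
have xX : `|xi| <= X by rewrite lerDl.
pose N := ((size Q).-1 + (size P).-1)%N.
have NE : N = ((size Q).-1 + (size P).-1)%N by [].
have Nmn : (N <= m + n)%N by rewrite /N addnC leq_add // -subn1 leq_subLR.
apply: le_trans (resultant_ge1 NE res0 X1 xX sP Q0 PH QH Pe Qe) _.
have -> : (m + n)%:R * ((m + n)`!%:R * X ^+ (m + n)) * (H ^+ (m + n).-1 * e)
  = (m + n)%:R * ((m + n)`!%:R * H ^+ (m + n).-1) * (X ^+ (m + n) * e) by ring.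
have N1 : (N.-1 <= (m + n).-1)%N by rewrite -!subn1 leq_sub2r.
rewrite !ler_pM ?mulr_ge0 ?exprn_ge0 ?(ltW X0) ?ler_nat ?ler_weXn2l //.
by apply: leq_fact; apply: leq_trans (leq_pred _) Nmn.
Qed.

End Approximation.

(** * Small polynomials of minimal degree *)

Section Minimal.

Variables (R : realType) (xi : R) (t : nat).
Implicit Types (P Q : {poly int}) (eps : R).

Definition apx P : R := `|peval P xi| * (height P)%:R ^+ t.

Definition arbitrarily_small k :=
  forall eps, 0 < eps -> exists P, [/\ P != 0, (size P <= k)%N & apx P <= eps].

Lemma height_ge1 P : P != 0 -> 1 <= (height P)%:R :> R.
Proof. by move=> P0; rewrite ler1n height_gt0. Qed.

Lemma apx_ge P : P != 0 -> `|peval P xi| <= apx P.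
Proof. by move=> P0; rewrite ler_peMr // exprn_ege1 // height_ge1. Qed.

(** The value is a nonzero integer. This keeps the minimal size above 1. *)
Lemma apx_const_ge1 P : P != 0 -> (size P <= 1)%N -> 1 <= apx P.
Proof.
move=> P0 sP; apply: le_trans (apx_ge P0).
have := P0; rewrite (size1_polyC sP) polyC_eq0 => c0.
rewrite /peval map_polyC hornerC /= -intr_norm -abszE -pmulrn ler1n.
by rewrite absz_gt0.
Qed.

Lemma apx_mul_le (c : R) P Q :
  (height P)%:R * (height Q)%:R <= c * (height (P * Q))%:R ->
  apx P * apx Q <= c ^+ t * apx (P * Q).
Proof.
move=> h; rewrite /apx pevalM normrM.
have -> : `|peval P xi| * (height P)%:R ^+ t *
    (`|peval Q xi| * (height Q)%:R ^+ t)
  = `|peval P xi| * `|peval Q xi| * ((height P)%:R * (height Q)%:R) ^+ t.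
  by rewrite exprMn; ring.
have -> : c ^+ t * (`|peval P xi| * `|peval Q xi| * (height (P * Q))%:R ^+ t)
  = `|peval P xi| * `|peval Q xi| * (c * (height (P * Q))%:R) ^+ t.
  by rewrite exprMn; ring.
have h0 : 0 <= (height P)%:R * (height Q)%:R :> R by rewrite mulr_ge0.
rewrite ler_wpM2l ?mulr_ge0 // lerXn2r // nnegrE.
exact: le_trans h.
Qed.

(** Dividing by the content, a nonzero integer, increases neither the value nor the height.
    Primitivity later turns divisibility up to scalars into divisibility over the integers. *)
Lemma apx_zprimitive_le P : P != 0 -> apx (zprimitive P) <= apx P.
Proof.
move=> P0; have c0 : 1 <= `|(zcontents P)%:~R : R|.
  by rewrite -intr_norm -abszE -pmulrn ler1n absz_gt0 zcontents_eq0.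
have PE : P = (zcontents P)%:P * zprimitive P by rewrite mul_polyC -zpolyEprim.
have PxE : peval P xi = (zcontents P)%:~R * peval (zprimitive P) xi.
  by rewrite {1}PE pevalM {1}/peval map_polyC hornerC.
rewrite /apx PxE normrM.
apply: ler_pM; rewrite ?exprn_ge0 // ?ler_peMl //.
rewrite lerXn2r ?nnegrE // ler_nat.
have [i ->] := height_coef (zprimitive P).
apply: leq_trans (coef_le_height P i).
have -> : P`_i = zcontents P * (zprimitive P)`_i by rewrite {1}PE coefCM.
by rewrite abszM leq_pmull // absz_gt0 zcontents_eq0.
Qed.

(* A minimal [k] makes every polynomial of size [k] with small [apx]
   essentially irreducible: a proper factor would have small [apx] too. *)
Lemma minimal_small_size L : arbitrarily_small L ->
  exists k, [/\ (1 < k <= L)%N, arbitrarily_small k & exists2 eps, 0 < eps &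
    forall P, P != 0 -> (size P < k)%N -> eps < apx P].
Proof.
move=> sL; have exE : exists k, `[< arbitrarily_small k >].
  by exists L; apply/asboolP.
case: (ex_minnP exE) => k /asboolP sk kmin; exists k.
have k1 : (1 < k)%N.
  rewrite ltnNge; apply/negP => k1.
  have [|P [P0 sP PE]] := sk (1 / 2); first by lra.
  by have := apx_const_ge1 P0 (leq_trans sP k1); lra.
split=> //; first by rewrite k1 kmin //; apply/asboolP.
(* Minimality of [k] fails the property at [k - 1], and the failing [eps] is the required lower
   bound. *)
have : ~ arbitrarily_small k.-1.
  by move/asboolP/kmin; rewrite leqNgt prednK ?leqnn // ltnW.
move=> /existsNP[eps /not_implyP[eps0 nP]]; exists eps => // P P0 sP.
rewrite ltNge; apply/negP => Pe; apply: nP; exists P; split=> //.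
by rewrite -ltnS prednK // ltnW.
Qed.

End Minimal.

(** * Incompatibility of the two kinds of approximation *)

Lemma no_simultaneous_approximation (R : realType) (xi : R) (m n : nat) :
  transcendental xi -> (0 < m + n)%N ->
  arbitrarily_small xi (m + n).-1 m.+1 ->
  ~ (forall eps : R, 0 < eps -> exists H0 : R, forall H, H0 <= H ->
      exists Q : {poly int}, [/\ Q != 0, (size Q <= n.+1)%N,
        `|peval Q xi| * H ^+ (m + n).-1 <= eps
        & (height Q)%:R <= H]).
Proof.
move=> tr mn0; set t := (m + n).-1.
move=> /minimal_small_size[k [/andP[k1 km] sk [e1 e10 kmin]]] unif.
have [c0 c00 hc0] := height_mul_le R (m.+1 + n.+1).
(* With [c >= 1], height at most [h / (2c)] also means height at most [h]. *)
pose c := c0 + 1.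
have c1 : 1 <= c by rewrite lerDr ltW.
have cgt0 : 0 < c by apply: lt_le_trans c1.
have ct0 : 0 < c ^+ t by rewrite exprn_gt0.
have hc (P Q : {poly int}) :
    (size P <= m.+1 + n.+1)%N -> (size Q <= m.+1 + n.+1)%N ->
    (height P)%:R * (height Q)%:R <= c * (height (P * Q))%:R.
  move=> sP sQ; apply: le_trans (hc0 _ _ sP sQ) _.
  by rewrite ler_wpM2r // lerDl.
have [G G0 hG] := resultant_small xi mn0.
have c2t0 : 0 < (2 * c) ^+ t by rewrite exprn_gt0 // mulr_gt0.
(* The factor [(2c)^t] compensates for using height [h / (2c)]: the outcome is
   [|Q(xi)| h^t <= 1/(2G)]. *)
have [|H0 unifH] := unif ((2 * G)^-1 / (2 * c) ^+ t).
  by rewrite divr_gt0 ?invr_gt0 ?mulr_gt0.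
pose N := Num.Def.archi_bound (2 * c * `|H0|).
have HN : 2 * c * `|H0| < N%:R by apply: archi_boundP; rewrite !mulr_ge0 // ltW.
have [d d0 dP] := peval_gt_of_bounded_height m.+1 N tr.
(* The four bounds serve in turn to force [A] to have size exactly [k], to force its height above
   [N], to exclude a proper factorisation, and to contradict a nonzero resultant. *)
pose del := Num.min (Num.min e1 d) (Num.min (e1 * e1 / c ^+ t) (2 * G)^-1).
have del0 : 0 < del.
  by rewrite !lt_min e10 d0 divr_gt0 ?invr_gt0 ?mulr_gt0.
have [A' [A'0 sA' A'del]] := sk _ del0.
pose A := zprimitive A'.
have A0 : A != 0 by rewrite zprimitive_eq0.
have : apx xi t A <= del by apply: le_trans (apx_zprimitive_le _ _ A'0) A'del.
rewrite !le_min => /andP[/andP[Ae1 Ad] /andP[Ae2 AG]].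
have sA : size A = k.
  apply/eqP; rewrite eqn_leq size_zprimitive sA' leqNgt /=.
  apply/negP => lt; have := kmin A A0.
  by rewrite size_zprimitive ltNge Ae1 => /(_ lt).
have hA : (N < height A)%N.
  rewrite ltnNge; apply/negP => le.
  have := dP A A0; rewrite sA => /(_ km le).
  by rewrite ltNge (le_trans (apx_ge _ _ A0) Ad).
pose h : R := (height A)%:R.
have h1 : 1 <= h by apply: height_ge1.
have hgt0 : 0 < h by apply: lt_le_trans h1.
have c20 : 0 < 2 * c by rewrite mulr_gt0.
have [|Q [Q0 sQ Qx Qh]] := unifH (h / (2 * c)).
  rewrite ler_pdivlMr // mulrC; apply: le_trans (_ : 2 * c * `|H0| <= _).
    by rewrite ler_pM2l // ler_norm.
  by apply: ltW (lt_trans HN _); rewrite ltr_nat.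
have Qh1 : (height Q)%:R <= h.
  apply: le_trans Qh _; rewrite ler_pdivrMr // ler_peMr ?(ltW hgt0) //.
  by apply: le_trans c1 _; rewrite ler_peMl ?(ltW cgt0) // ler1n.
have ht0 : 0 < h ^+ t by rewrite exprn_gt0.
(* If the resultant is nonzero, [e = 1/(2G h^t)] gives [1 <= G h^t e = 1/2]. *)
have [res0|res0] := eqVneq (resultant A Q) 0; last first.
  have := hG A Q h ((2 * G)^-1 / h ^+ t) res0.
  rewrite sA k1 km => /(_ isT Q0 sQ h1 (lexx _) Qh1).
  rewrite !ler_pdivlMr // => /(_ AG).
  have -> : `|peval Q xi| * h ^+ t
      = `|peval Q xi| * (h / (2 * c)) ^+ t * (2 * c) ^+ t.
    by rewrite -mulrA -exprMn divfK // gt_eqF.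
  rewrite -ler_pdivlMr // => /(_ Qx).
  rewrite (mulrC (h ^+ t)) divfK ?gt_eqF // invfM mulrCA divff ?gt_eqF //.
  by lra.
pose g := gcdp A Q; pose B := zprimitive g.
have sg : (1 < size g)%N by rewrite -resultant_eq0 res0.
have g0 : g != 0 by rewrite -size_poly_gt0 ltnW.
have sB : size B = size g by apply: size_zprimitive.
have sgk : (size g <= k)%N by rewrite -sA; apply: dvdp_leq; rewrite ?dvdp_gcdl.
have le_k_K : (k <= m.+1 + n.+1)%N by rewrite (leq_trans km) // leq_addr.
(* A gcd of full size means that [A] divides [Q], over the integers because [A] is primitive.
   Gelfond's inequality then gives [h <= c H(Q) <= h/2]. *)
have [gk|gk] := eqVneq (size g) k.
  have AQ : (A %| Q)%R.
    have : g %= A by rewrite -dvdp_size_eqp ?dvdp_gcdl // gk sA.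
    by move/eqp_dvdl <-; rewrite dvdp_gcdr.
  have [r] := dvdpP_int AQ; rewrite zprimitive_id -/A => QE.
  have r0 : r != 0 by apply: contraNneq Q0 => r0; rewrite QE r0 mulr0.
  have sr : (size r <= m.+1 + n.+1)%N.
    apply: leq_trans (leq_trans sQ (leq_addl _ _)).
    apply: dvdp_leq Q0 _.
    by rewrite QE dvdp_mull.
  have := hc A r; rewrite sA -QE => /(_ le_k_K sr) hh.
  have : h <= c * (height Q)%:R.
    by apply: le_trans hh; rewrite ler_peMr // height_ge1.
  have : c * (height Q)%:R <= h / 2.
    have := Qh; rewrite ler_pdivlMr // => Qh'; lra.
  by lra.
(* Otherwise [A = B C] with both sizes below [k], so that [e1^2 < apx B * apx C <= c^t * apx A <=
   e1^2]. *)
have ltgk : (size g < k)%N by rewrite ltn_neqAle gk.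
have [C AE] := dvdpP_int (dvdp_gcdl A Q).
rewrite -/g -/B in AE.
have B0 : B != 0 by rewrite zprimitive_eq0.
have C0 : C != 0 by apply: contraNneq A0 => C0; rewrite AE C0 mulr0.
have sC : (size C < k)%N.
  rewrite -sA AE size_mul // sB -(prednK (ltnW sg)) addSn /=.
  by rewrite -[ltnLHS]add0n ltn_add2r -subn1 subn_gt0.
have BC : apx xi t B * apx xi t C <= c ^+ t * apx xi t (B * C).
  by apply/apx_mul_le/hc; rewrite ?sB (leq_trans _ le_k_K) // ltnW.
move: Ae2; rewrite ler_pdivlMr // mulrC AE => /(le_trans BC).
have Be : e1 < apx xi t B by rewrite kmin // sB.
apply/negP; rewrite -ltNge.
exact: ltr_pM (ltW e10) (ltW e10) Be (kmin C C0 sC).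
Qed.

Theorem theorem2p3 (R : realType) (m n : nat) (xi : R)
    (hm : (0 < m)%N) (hn : (0 < n)%N) (hxi : transcendental xi) :
  (mine (w_exp m xi) (what_exp n xi) <= (m%:R + n%:R - 1)%:E)%E.
Proof.
rewrite leNgt lt_min; apply/negP => /andP[].
have mn0 : (0 < m + n)%N by rewrite addn_gt0 hm.
have -> : m%:R + n%:R - 1 = (m + n).-1%:R :> R.
  by rewrite -natrD -{1}(prednK mn0) -natr1 addrK.
(* A supremum above [t] yields an admissible exponent strictly above [t], so infinite exponents need
   no separate case. *)
move=> /ereal_sup_gt[_ [w ww <-]]; rewrite lte_fin => tw.
move=> /ereal_sup_gt[_ [w' ww' <-]]; rewrite lte_fin => tw'.
exact: no_simultaneous_approximation hxi mn0 (w_set_small ww tw)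
  (what_set_small ww' tw').
Qed.
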